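(* Let $b\ge2$ be an integer, let $n$ be a positive integer (the number of summands), and let $p\ge1$ satisfy $\frac{b-1}{p}\in\mathbf N$ (for the upper signs), respectively $\frac{b+1}{p}\in\mathbf N$ (for the lower signs). Let $\{\kappa_r^{\pm}\}_{r\ge0}$ be the $(\pm b,n,p)$-carries process started with $\kappa_0^{\pm}$ distributed according to its stationary distribution $\pi$. Then, for every integer $r\ge0$: (1) $\displaystyle \mathbf E_\pi[\kappa_0^{\pm}]=\frac{n+1}{2}-\frac1p$; (2) $\displaystyle \mathrm{Cov}_\pi(\kappa_r^{\pm},\kappa_0^{\pm})=\frac{1}{(\pm b)^r}\cdot\frac{n+1}{12}$.
   Context: $\mathbf N$ is the set of positive integers. $\mathcal D(b)=\{0,1,\dots,b-1\}$. $\mathcal C_p(n)=\{0,1,\dots,n-1\}$ if $p=1$ and $\mathcal C_p(n)=\{0,1,\dots,n\}$ if $p\neq 1$. The $(\pm b,n,p)$-carries process $\{\kappa_k^{\pm}\}_{k\ge 0}$ is the Markov chain on $\mathcal C_p(n)$ defined as follows. Given $\kappa^{\pm}_{k-1}$, draw $Y_1,\dots,Y_n$ independently and uniformly from $\mathcal D(b)$ (independently of the past); then $\kappa_k^{\pm}$ is the unique integer for which there is $s\in\mathcal D(b)$ with $$\kappa^{+}_{k-1}+Y_1+\dots+Y_n+A_+(b)=\kappa^+_k\,b+s \quad\text{(for }+b),\qquad \kappa^{-}_{k-1}+Y_1+\dots+Y_n+A_-(b)=(n-\kappa^-_k)\,b+s\quad\text{(for }-b),$$ where $A_+(b)=(b-1)\left(1-\frac1p\right)$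 and $A_-(b)=\frac{b+1}{p}-1$. This chain is irreducible and aperiodic, so it has a unique stationary distribution $\pi$; $\mathbf E_\pi$ and $\mathrm{Cov}_\pi$ denote expectation and covariance when $\kappa_0^{\pm}\sim\pi$.
   Formalization: The covariance formula (2) is stated only for n ≥ 2, since it fails for n = 1 (for example b = 3, p = 2, sign +: the variance is 1/4, not 1/6); the mean formula (1) is stated for all n ≥ 1. *)

(* Defs.v *)
From HB Require Import structures.
From mathcomp Require Import all_boot all_order all_algebra.
From mathcomp Require Import all_classical all_reals all_analysis.

Set Implicit Arguments.
Unset Strict Implicit.
Unset Printing Implicit Defensive.

Import Order.TTheory GRing.Theory Num.Theory.

Local Open Scope classical_set_scope.
Local Open Scope ring_scope.

(* Stationary distributions and Markov chains on a finite state space, for a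
   transition matrix Q given as a function. *)

Definition is_stationary_distribution (R : realType) (S : finType)
    (Q : S -> S -> R) (mu : S -> R) : Prop :=
  [/\ forall i, 0 <= mu i,
      \sum_i mu i = 1
    & forall j, \sum_i mu i * Q i j = mu j].

(* The last clause is
     P(X_(m+1) = j | X_0 = x_0, ..., X_m = x_m) = Q x_m j,
   multiplied by the probability of the conditioning event, which may be 0. *)
Definition is_markov_chain (d : measure_display) (T : measurableType d)
    (R : realType) (P : probability T R) (S : finType)
    (mu : S -> R) (Q : S -> S -> R) (X : nat -> T -> S) : Prop :=
  [/\ forall k i, measurable (X k @^-1` [set i]),
      forall i, P (X 0%N @^-1` [set i]) = (mu i)%:E
    & forall (m : nat) (x : nat -> S) (j : S),
        P ([set w | forall k, (k <= m)%N -> X k w = x k]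
             `&` X m.+1 @^-1` [set j]) =
        (P [set w | forall k, (k <= m)%N -> X k w = x k] * (Q (x m) j)%:E)%E].

(* In all that follows, the flag [neg] selects the sign of the base: [false]
   is the process in base +b, [true] the process in base -b. *)

Definition signed_base (R : realType) (neg : bool) (b : nat) : R :=
  (-1) ^+ neg * b%:R.

Definition admissible (R : realType) (neg : bool) (b : nat) (p : R) : Prop :=
  exists2 m : nat, (0 < m)%N &
    (if neg then b%:R + 1 else b%:R - 1) / p = m%:R.

Definition carries_shift (R : realType) (neg : bool) (b : nat) (p : R) : R :=
  if neg then (b%:R + 1) / p - 1 else (b%:R - 1) * (1 - 1 / p).

Definition carries_card (R : realType) (n : nat) (p : R) : nat :=
  if p == 1 then n else n.+1.

Definition carries_state (R : realType) (n : nat) (p : R) : finType :=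
  'I_(carries_card n p).

(* With carry i and drawn digits y, the next carry is j. *)
Definition carries_step (R : realType) (neg : bool) (b n : nat) (p : R)
    (i : carries_state n p) (y : {ffun 'I_n -> 'I_b}) (j : carries_state n p)
    : bool :=
  [exists s : 'I_b,
    (i : nat)%:R + \sum_(k < n) (y k : nat)%:R + carries_shift neg b p ==
    (if neg then n%:R - (j : nat)%:R else (j : nat)%:R) * b%:R
      + (s : nat)%:R :> R].

(* n independent uniform digits form a uniform element of
   {ffun 'I_n -> 'I_b}, a type of cardinal b ^ n. *)
Definition carries_transition (R : realType) (neg : bool) (b n : nat) (p : R)
    (i j : carries_state n p) : R :=
  #|[pred y : {ffun 'I_n -> 'I_b} | carries_step neg i y j]|%:R / (b ^ n)%:R.

Definition is_carries_process (d : measure_display) (T : measurableType d)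
    (R : realType) (P : probability T R) (neg : bool) (b n : nat) (p : R)
    (mu : carries_state n p -> R) (kappa : nat -> T -> carries_state n p)
    : Prop :=
  is_markov_chain P mu (@carries_transition R neg b n p) kappa.

Definition carry_value (R : realType) (T : Type) (n : nat) (p : R)
    (kappa : nat -> T -> carries_state n p) (r : nat) (w : T) : R :=
  (kappa r w : nat)%:R.

(* Main.v *)
Require Import Defs.
From mathcomp Require Import all_boot all_order all_algebra.
From mathcomp Require Import all_classical all_reals all_analysis.
From mathcomp Require Import ring lra zify.
Import Order.TTheory GRing.Theory Num.Theory.
Local Open Scope ring_scope.
Set Implicit Arguments.
Unset Strict Implicit.
Unset Printing Implicit Defensive.

(** Write c for the signed base, h(i) = i - ((n + 1) / 2 - 1 / p) for the
    centred carry, and dev(a) = a - (b - 1) / 2 for a centred digit.  One step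
    of the process, from i to j, is a division with remainder by b of
    T = i + y_1 + ... + y_n + A, where A is the shift.  Once everything is
    centred, the constants cancel and the step reads
      c h(j) = h(i) + dev(y_1) + ... + dev(y_n) - dev(s),   s = T mod b
    ([carries_step_next]).

    The idea is to treat s as one more digit.  Resampling a single y_k makes s
    run through all residues, whatever the other digits are, so s is uniform
    and, when there are at least two summands, independent of each single y_k.
    Hence the n + 1 noise terms have mean 0 and variance v = (b^2 - 1) / 12,
    and they are pairwise uncorrelated ([sum_noise], [sum_noise_mul]).  So
      E[h(j) | i] = h(i) / c   and   E[h(j)^2 | i] = (h(i)^2 + (n + 1) v) / b^2.

    Averaging under the stationary law gives E[h] = E[h] / c, so E[h] = 0, and
    E[h^2] (1 - 1 / b^2) = (n + 1) v / b^2, so E[h^2] = (n + 1) / 12.  The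
    denominator 12 is that of the variance of a digit, and the factor n + 1
    counts the digits together with the remainder.

    Finally h is an eigenfunction of the transition operator with eigenvalue
    1 / c, so each step of the chain multiplies E[h(kappa_0) h(kappa_r)] by
    1 / c ([expectation_markov_eigen]), starting from E[h^2] at r = 0. *)

(** * Uniform digits and the remainder of their sum *)

Section Digits.
Variables (R : realType) (b : nat).
Hypothesis b_gt0 : (0 < b)%N.

Definition digit_mean : R := (b%:R - 1) / 2.
Definition digit_var : R := (b%:R ^+ 2 - 1) / 12.
Definition digit_dev (a : nat) : R := a%:R - digit_mean.

Lemma sum_digit_dev : \sum_(a < b) digit_dev a = 0.
Proof.
have E c m : \sum_(a < m) ((a : nat)%:R - c) = m%:R * ((m%:R - 1) / 2 - c) :> R.
  elim: m => [|m IH]; first by rewrite big_ord0 mul0r.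
  by rewrite big_ord_recr /= IH -natr1; field.
by rewrite /digit_dev E subrr mulr0.
Qed.

Lemma sum_digit_dev_sqr : \sum_(a < b) digit_dev a ^+ 2 = b%:R * digit_var.
Proof.
have E c m : \sum_(a < m) ((a : nat)%:R - c) ^+ 2
    = m%:R * ((m%:R - 1) * (2 * m%:R - 1) / 6 - c * (m%:R - 1) + c ^+ 2) :> R.
  elim: m => [|m IH]; first by rewrite big_ord0 mul0r.
  by rewrite big_ord_recr /= IH -natr1; field.
by rewrite /digit_dev E /digit_mean /digit_var; field.
Qed.

Lemma sum_modn_shift (f : nat -> R) (x : nat) :
  \sum_(a < b) f ((x + a) %% b)%N = \sum_(a < b) f a.
Proof.
elim: x => [|x <-]; first by apply: eq_bigr => a _; rewrite add0n modn_small.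
case: b b_gt0 => // c _.
rewrite big_ord_recr [RHS]big_ord_recl /= addrC addn0; congr (_ + _).
  by rewrite addSnnS modnDr.
by apply: eq_bigr => a _; rewrite addSnnS /bump.
Qed.

Variable n : nat.
Implicit Types (y : {ffun 'I_n -> 'I_b}) (F : {ffun 'I_n -> 'I_b} -> R).

Definition resample y (k : 'I_n) (a : 'I_b) : {ffun 'I_n -> 'I_b} :=
  [ffun l => if l == k then a else y l].

(** Exchanging the digit y_k with a fresh digit a is an involution on the
    pairs (y, a), hence measure preserving. *)
Lemma sum_resample F (k : 'I_n) :
  \sum_y \sum_a F (resample y k a) = b%:R * \sum_y F y.
Proof.
pose swap (u : {ffun 'I_n -> 'I_b} * 'I_b) := (resample u.1 k u.2, u.1 k).
have swapK : involutive swap.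
  case=> y a; rewrite /swap /=; congr (_, _); last by rewrite ffunE eqxx.
  by apply/ffunP => l; rewrite !ffunE; case: eqP => // ->.
rewrite pair_big /= (reindex_inj (inv_inj swapK)) /=.
rewrite (eq_bigr (fun u => F u.1)); last first.
  by move=> u _; congr F; exact: (congr1 fst (swapK u)).
rewrite -(pair_big xpredT xpredT (fun y _ => F y)) /= mulr_sumr.
by apply: eq_bigr => y _; rewrite sumr_const card_ord mulr_natl.
Qed.

(** The law of total expectation, conditioning on all digits but y_k; this is
    how all moments of the noise are computed. *)
Lemma sum_of_resample F (k : 'I_n) (c : R) :
    (forall y, \sum_a F (resample y k a) = b%:R * c) ->
  \sum_y F y = (b ^ n)%:R * c.
Proof.
move=> Fc; have b0 : b%:R != 0 :> R by rewrite pnatr_eq0 -lt0n.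
apply: (mulfI b0); rewrite -(sum_resample F k) (eq_bigr _ (fun y _ => Fc y)).
by rewrite sumr_const card_ffun !card_ord -[LHS]mulr_natl mulrCA.
Qed.

(** The n + 1 error terms of a step: [Some k] stands for the k-th digit and
    [None] for the remainder, which enters with a minus sign. *)
Definition noise (x : nat) y (o : option 'I_n) : R :=
  if o is Some k then digit_dev (y k)
  else - digit_dev ((x + \sum_k y k) %% b)%N.

(** Translation permutes the residues modulo b, so resampling one digit is
    enough to make the remainder uniform. *)
Lemma sum_resample_modn (f : nat -> R) x y (k : 'I_n) :
  \sum_a f ((x + \sum_l resample y k a l) %% b)%N = \sum_(a < b) f a.
Proof.
rewrite -(sum_modn_shift f (x + \sum_(l | l != k) y l)).
apply: eq_bigr => a _; congr (f (_ %% b)%N).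
rewrite (bigD1 k) //= ffunE eqxx addnCA addnC; congr (_ + _ + _)%N.
by apply: eq_bigr => l /negbTE lk; rewrite ffunE lk.
Qed.

Lemma sum_noise x o : (0 < n)%N -> \sum_y noise x y o = 0.
Proof.
move=> n0; rewrite -[RHS](mulr0 (b ^ n)%:R).
case: o => [k|] /=.
  apply: (sum_of_resample (k := k)) => y; rewrite mulr0 -[RHS]sum_digit_dev.
  by apply: eq_bigr => a _; rewrite ffunE eqxx.
apply: (sum_of_resample (k := Ordinal n0)) => y.
by rewrite sumrN sum_resample_modn sum_digit_dev mulr0 oppr0.
Qed.

(** With two summands or more, the remainder is uncorrelated with y_k because
    it is already uniform when only another digit y_l is resampled. *)
Lemma sum_noise_mul x (o o' : option 'I_n) : (1 < n)%N ->
  \sum_y noise x y o * noise x y o'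
  = (b ^ n)%:R * (if o == o' then digit_var else 0).
Proof.
move=> n1.
have mixed k : \sum_y noise x y (Some k) * noise x y None = (b ^ n)%:R * 0.
  have [l lk] : exists l : 'I_n, l != k.
    have : (0 < #|predC1 k|)%N by rewrite cardC1 card_ord -ltnS prednK // ltnW.
    by case/card_gt0P => l lk; exists l.
  apply: (sum_of_resample (k := l)) => y /=.
  transitivity (\sum_a digit_dev (y k) *
     - digit_dev ((x + \sum_l0 resample y l a l0) %% b)%N).
    by apply: eq_bigr => a _; rewrite [in X in X * _]ffunE eq_sym (negbTE lk).
  by rewrite -mulr_sumr sumrN sum_resample_modn sum_digit_dev oppr0 !mulr0.
case: o o' => [k|] [l|] /=.
- rewrite (inj_eq (@Some_inj _)); apply: (sum_of_resample (k := k)) => y.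
  case: eqVneq => [<-|kl].
    rewrite -sum_digit_dev_sqr; apply: eq_bigr => a _.
    by rewrite ffunE eqxx expr2.
  transitivity (\sum_(a < b) digit_dev a * digit_dev (y l)); last first.
    by rewrite -mulr_suml sum_digit_dev mul0r mulr0.
  by apply: eq_bigr => a _; rewrite !ffunE eqxx eq_sym (negbTE kl).
- exact: mixed.
- by rewrite -(mixed l); apply: eq_bigr => y _; rewrite mulrC.
apply: (sum_of_resample (k := Ordinal (ltnW n1))) => y.
rewrite -sum_digit_dev_sqr.
rewrite -(sum_resample_modn (fun s => digit_dev s ^+ 2) x y
  (Ordinal (ltnW n1))).
by apply: eq_bigr => a _; rewrite mulrNN expr2.
Qed.
End Digits.

(** Pythagoras: the terms of the noise are centred and pairwise orthogonal for
    the uniform law on [Y], so all cross products drop out of the square. *)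
Lemma sum_sqr_uncorrelated (R : realType) (Y J : finType) (xi : Y -> J -> R)
    (h v : R) :
    (forall j, \sum_y xi y j = 0) ->
    (forall i j, \sum_y xi y i * xi y j = #|Y|%:R * (if i == j then v else 0)) ->
  \sum_y (h + \sum_j xi y j) ^+ 2 = #|Y|%:R * (h ^+ 2 + #|J|%:R * v).
Proof.
move=> xi0 xiv.
transitivity (\sum_y (h ^+ 2 + 2 * h * \sum_j xi y j
                      + \sum_i \sum_j xi y i * xi y j)).
  apply: eq_bigr => y _; rewrite sqrrD expr2 -mulr_natl mulrA.
  congr (_ + _); rewrite expr2 mulr_suml.
  by apply: eq_bigr => i _; rewrite mulr_sumr.
rewrite !big_split /= sumr_const -mulr_sumr exchange_big /= big1 // mulr0 addr0.
rewrite mulrDr mulr_natl; congr (_ + _); rewrite exchange_big /=.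
under eq_bigr => i _ do rewrite exchange_big /= (eq_bigr _ (fun j _ => xiv i j)).
transitivity (\sum_(i : J) #|Y|%:R * v).
  apply: eq_bigr => i _; rewrite (bigD1 i) //= eqxx big1 ?addr0 // => j ji.
  by rewrite eq_sym (negbTE ji) mulr0.
by rewrite sumr_const -[LHS]mulr_natl mulrCA.
Qed.

Lemma big_option (R : realType) (J : finType) (F : option J -> R) :
  \sum_o F o = F None + \sum_j F (Some j).
Proof.
rewrite (bigD1 None) //=; congr (_ + _).
rewrite (reindex_omap Some id) => [|[]] //=.
by apply: eq_bigl => j; rewrite eqxx.
Qed.

(** * One step of the carries process *)

Section Carry.
Variables (R : realType) (neg : bool) (b n : nat) (p : R).
Hypotheses (b_ge2 : (2 <= b)%N) (n_gt0 : (0 < n)%N) (p_ge1 : 1 <= p).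
Hypothesis b_adm : admissible neg b p.
Implicit Types (i j : carries_state n p) (y : {ffun 'I_n -> 'I_b}).

Definition carry_mean : R := (n%:R + 1) / 2 - 1 / p.
Definition carry_dev i : R := (i : nat)%:R - carry_mean.

(** Admissibility makes the shift a natural number; its size is what keeps the
    next carry inside the state space.  When p = 1 the state n is absent: the
    shift 0 prevents the quotient from reaching n in base +b, and the shift b
    prevents it from being 0 in base -b. *)
Lemma carries_shift_nat :
  exists2 A : nat, carries_shift neg b p = A%:R &
    if neg then (if p == 1%R then A == b else A < b)%N
    else (if p == 1%R then A == 0 else A.+1 < b)%N.
Proof.
case: b_adm => m m_gt0; rewrite /carries_shift.
have p0 : p != 0 by rewrite gt_eqF // (lt_le_trans ltr01).
have b_gt0 : (0 < b)%N by exact: ltnW.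
case: neg => /= mp.
  exists m.-1; first by rewrite mp -subn1 natrB.
  have mp' : m%:R * p = b.+1%:R by rewrite -mp divfK // natr1.
  case: eqVneq => [p1|p1].
    have /eqP : m%:R == b.+1%:R :> R by rewrite -mp' p1 mulr1.
    by move/eqP; rewrite eqr_nat => /eqP ->.
  have : (m < b.+1)%N.
    rewrite -(ltr_nat R) -mp' ltr_pMr ?ltr0n //.
    by rewrite lt_neqAle eq_sym p1.
  by rewrite -{1}(prednK m_gt0).
have mp' : m%:R * p = b.-1%:R by rewrite -mp divfK // -subn1 natrB.
have bm : (m <= b.-1)%N by rewrite -(ler_nat R) -mp' ler_peMr ?ler0n.
exists (b.-1 - m)%N.
  rewrite natrB // -mp -subn1 natrB //; field; exact: p0.
case: eqVneq => [p1|p1] /=.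
  have /eqP : m%:R == b.-1%:R :> R by rewrite -mp' p1 mulr1.
  by move/eqP; rewrite eqr_nat => /eqP ->; rewrite subnn.
have : (m < b.-1)%N; last by lia.
by rewrite -(ltr_nat R) -mp' ltr_pMr ?ltr0n // lt_neqAle eq_sym p1.
Qed.

(** The quotient and remainder of a division are unique, hence so is the next
    carry.  The identity has no constant term because [carry_mean] is the fixed
    point of the affine map sending the mean of a carry to the mean of the
    next one. *)
Lemma carries_step_next : exists A : nat, forall i y,
  exists2 j, (forall j', carries_step neg i y j' = (j' == j)) &
    signed_base R neg b * carry_dev j
    = carry_dev i + \sum_o noise R (i + A) y o.
Proof.
have [A shiftA boundA] := carries_shift_nat; exists A => i y.
set T := (i + A + \sum_k y k)%N.
have b_gt0 : (0 < b)%N by exact: ltnW.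
have sum_y : (\sum_k y k <= n * b.-1)%N.
  rewrite -[X in (_ <= X * _)%N]card_ord -sum_nat_const leq_sum // => k _.
  by rewrite -ltnS prednK.
have TE : (T %/ b * b + T %% b = T)%N by rewrite -divn_eq.
have sb : (T %% b < b)%N by rewrite ltn_mod.
have Db : (T %/ b <= n)%N /\
    ((if neg then n - T %/ b else T %/ b) < carries_card n p)%N.
  have ib : (i < carries_card n p)%N := ltn_ord i.
  have nb : (n * b = n * b.-1 + n)%N by rewrite -{1}(prednK b_gt0) mulnS addnC.
  have TT : (T = i + A + \sum_k y k)%N by [].
  move: ib boundA (T %/ b)%N (T %% b)%N TE sb TT; rewrite /carries_card.
  move: T (i : nat) (\sum_k y k)%N sum_y => T i' Y sumY ib boundA D s TE sb TT.
  (* In each of the four cases T < (n + 1) b. *)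
  have Dn : (D <= n)%N.
    rewrite -ltnS -(ltn_pmul2r b_gt0) mulSn.
    by move: ib boundA; case: neg; case: (p == 1) => /=; lia.
  split=> //; move: ib boundA; case: neg; case: (p == 1) => /= ib boundA;
    rewrite ?ltnS ?leq_subr //.
    have : (0 < D)%N; last by lia.
    by rewrite lt0n; apply/eqP => D0; move: TE; rewrite D0; lia.
  by rewrite -(ltn_pmul2r b_gt0); lia.
have stepE (j' : carries_state n p) : carries_step neg i y j' =
    ((j' : nat) == (if neg then n - T %/ b else T %/ b)%N).
  have -> : carries_step neg i y j' =
     [exists s : 'I_b, if neg then (T + j' * b == n * b + s)%N
                       else (T == j' * b + s)%N].
    apply: eq_existsb => s; rewrite shiftA.
    have -> : (i : nat)%:R + \sum_(k < n) (y k : nat)%:R + A%:R = T%:R :> R.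
      by rewrite /T !natrD natr_sum addrAC.
    case: neg; rewrite -(eqr_nat R) !natrD !natrM //.
    by rewrite mulrBl -subr_eq0 -[RHS]subr_eq0; congr (_ == 0); ring.
  have j'n : (j' <= n)%N.
    by have := ltn_ord j'; rewrite {2}/carries_card; case: ifP => // _ /ltnW.
  move: Db => [Dn _].
  apply/existsP/eqP => [[s]|].
    have divE q c : (c < b)%N -> ((q * b + c) %/ b)%N = q.
      by move=> cb; rewrite divnMDl // divn_small // addn0.
    case: neg => /eqP E; last by rewrite E divE.
    have nE : (T %/ b + j' = n)%N; last by lia.
    by rewrite -(divE (T %/ b + j')%N (T %% b)%N) // mulnDl addnAC TE E divE.
  case: neg => E; exists (Ordinal sb) => /=; apply/eqP.
    rewrite -{1}TE addnAC -mulnDl E subnKC //.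
  by rewrite E TE.
have p0 : p != 0 by rewrite gt_eqF // (lt_le_trans ltr01).
exists (Ordinal Db.2) => [j'|]; first by rewrite stepE.
have -> : \sum_o noise R (i + A) y o = 
    (\sum_k (y k : nat)%:R - n%:R * digit_mean R b) - digit_dev R b (T %% b).
  rewrite big_option /= addrC; congr (_ + _).
  by rewrite sumrB sumr_const card_ord mulr_natl.
have TR : (T %/ b)%:R * b%:R + (T %% b)%:R
    = (i : nat)%:R + A%:R + \sum_k (y k : nat)%:R :> R.
  have := congr1 (fun t => t%:R : R) TE; rewrite natrD natrM => ->.
  by rewrite /T !natrD natr_sum.
move: shiftA; rewrite /carries_shift /signed_base /carry_dev /carry_mean /=.
rewrite /digit_dev /digit_mean.
have {TR} -> : \sum_(k < n) (y k : nat)%:R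
    = (T %/ b)%:R * b%:R + (T %% b)%:R - (i : nat)%:R - A%:R :> R.
  by rewrite TR; ring.
by case: Db => Dn _; case: neg => <-; rewrite ?natrB // ?expr1 ?expr0; field.
Qed.
End Carry.

(** * Moments of the transition kernel and of the stationary law *)

Section Moments.
Variables (R : realType) (neg : bool) (b n : nat) (p : R).
Hypotheses (b_ge2 : (2 <= b)%N) (n_gt0 : (0 < n)%N) (p_ge1 : 1 <= p).
Hypothesis b_adm : admissible neg b p.
Implicit Types (i j : carries_state n p) (y : {ffun 'I_n -> 'I_b}).
Let b_gt0 : (0 < b)%N := ltnW b_ge2.
Let c : R := signed_base R neg b.
Let Q : carries_state n p -> carries_state n p -> R :=
  @carries_transition R neg b n p.

(** The kernel counts digit vectors, so integrating against it is averaging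
    over the digits, provided that each digit vector leads to one state. *)
Lemma sum_carries_transition i (f : carries_state n p -> R) g :
    (forall y, exists2 j, (forall j', carries_step neg i y j' = (j' == j)) &
                          f j = g y) ->
  \sum_j Q i j * f j = (\sum_y g y) / (b ^ n)%:R.
Proof.
move=> next.
transitivity ((\sum_j \sum_(y : {ffun 'I_n -> 'I_b})
    (carries_step neg i y j)%:R * f j) / (b ^ n)%:R).
  rewrite mulr_suml; apply: eq_bigr => j _; rewrite /Q /carries_transition.
  rewrite mulrAC -mulr_suml -sum1_card natr_sum; congr (_ * _ / _).
  by rewrite [LHS]big_mkcond; apply: eq_bigr => y _; rewrite inE; case: ifP.
rewrite exchange_big; congr (_ / _); apply: eq_bigr => y _.
have [j stepj <-] := next y.
rewrite (bigD1 j) //= stepj eqxx mul1r big1 ?addr0 // => j' /negbTE j'j.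
by rewrite stepj j'j mul0r.
Qed.

Lemma signed_base_neq0 : c != 0.
Proof.
by rewrite mulf_neq0 ?signr_eq0 // pnatr_eq0 -lt0n.
Qed.

Lemma signed_base_sqr : c ^+ 2 = b%:R ^+ 2.
Proof. by rewrite exprMn sqrr_sign mul1r. Qed.

Lemma sqr_base_gt1 : 1 < b%:R ^+ 2 :> R.
Proof. by rewrite exprn_egt1 // ltr1n. Qed.

Lemma carries_transition_dev i :
  \sum_j Q i j * carry_dev j = c^-1 * carry_dev i.
Proof.
have [A nextA] := carries_step_next b_ge2 n_gt0 p_ge1 b_adm.
rewrite (@sum_carries_transition i _
    (fun y => c^-1 * (carry_dev i + \sum_o noise R (i + A) y o))); last first.
  move=> y; have [j stepj cj] := nextA i y; exists j => //.
  by rewrite -cj mulKf ?signed_base_neq0.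
rewrite -mulr_sumr -mulrA; congr (_ * _); rewrite big_split /= exchange_big /=.
rewrite [X in _ + X]big1 => [|o _]; last exact: sum_noise.
rewrite addr0 sumr_const card_ffun !card_ord -[X in X / _]mulr_natr mulfK //.
by rewrite pnatr_eq0 -lt0n expn_gt0 b_gt0.
Qed.

Lemma carries_transition_dev_sqr i : (1 < n)%N ->
  \sum_j Q i j * carry_dev j ^+ 2
  = (carry_dev i ^+ 2 + n.+1%:R * digit_var R b) / b%:R ^+ 2.
Proof.
move=> n1; have [A nextA] := carries_step_next b_ge2 n_gt0 p_ge1 b_adm.
rewrite (@sum_carries_transition i _
    (fun y => (carry_dev i + \sum_o noise R (i + A) y o) ^+ 2 / b%:R ^+ 2)).
  rewrite -mulr_suml mulrAC; congr (_ / _).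
  rewrite (@sum_sqr_uncorrelated _ _ _ _ _ (digit_var R b)); first last.
  - by move=> o o'; rewrite card_ffun !card_ord sum_noise_mul.
  - by move=> o; rewrite sum_noise.
  rewrite card_option card_ffun !card_ord mulrAC mulfV ?mul1r //.
  by rewrite pnatr_eq0 -lt0n expn_gt0 b_gt0.
move=> y; have [j stepj cj] := nextA i y; exists j => //.
rewrite -cj -signed_base_sqr exprMn mulrAC mulfV ?mul1r //.
by rewrite expf_neq0 // signed_base_neq0.
Qed.

Variable mu : carries_state n p -> R.
Hypothesis mu_stat : is_stationary_distribution Q mu.

Lemma stationary_sum f : \sum_i mu i * f i = \sum_i mu i * \sum_j Q i j * f j.
Proof.
case: mu_stat => _ _ muQ; under [RHS]eq_bigr do rewrite mulr_sumr.
rewrite exchange_big; apply: eq_bigr => j _; rewrite -{1}muQ mulr_suml.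
by apply: eq_bigr => i _; rewrite mulrA.
Qed.

(** A step multiplies the mean by 1 / c, which is not 1, and leaves it
    invariant. *)
Lemma stationary_dev : \sum_i mu i * carry_dev i = 0.
Proof.
set S := LHS.
have : S = c^-1 * S.
  rewrite {1}/S stationary_sum mulr_sumr; apply: eq_bigr => i _.
  by rewrite carries_transition_dev mulrCA.
have c1 : c^-1 != 1.
  rewrite invr_eq1; apply/eqP => /(congr1 (fun x => x ^+ 2)) /eqP.
  by rewrite signed_base_sqr expr1n gt_eqF // sqr_base_gt1.
move=> E; apply/eqP; have : (1 - c^-1) * S == 0 by rewrite mulrBl mul1r -E subrr.
by rewrite mulf_eq0 subr_eq0 eq_sym (negbTE c1).
Qed.

(** The variance V solves V = (V + (n + 1) v) / b^2, and b^2 is not 1. *)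
Lemma stationary_dev_sqr : (1 < n)%N ->
  \sum_i mu i * carry_dev i ^+ 2 = (n%:R + 1) / 12.
Proof.
move=> n1; set S := LHS.
have b2 : b%:R ^+ 2 - 1 != 0 :> R.
  by rewrite subr_eq0 gt_eqF // sqr_base_gt1.
have b0 : b%:R != 0 :> R by rewrite pnatr_eq0 -lt0n.
have E : S = (S + n.+1%:R * digit_var R b) / b%:R ^+ 2.
  rewrite {1}/S stationary_sum mulrDl.
  under eq_bigr do rewrite carries_transition_dev_sqr // mulrDl mulrDr mulrA.
  by rewrite big_split /= -!mulr_suml; case: mu_stat => _ -> _; rewrite mul1r.
apply: (mulIf b2); rewrite mulrBr mulr1 {1}E divfK ?expf_neq0 // /digit_var -natr1.
by field.
Qed.
End Moments.

(** * Expectations along a finite Markov chain *)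

Section FiniteChain.
Variables (d : measure_display) (T : measurableType d) (R : realType).
Variable P : probability T R.

Lemma expectation_finite (F : finType) (Z : T -> F) (f : F -> R) :
    (forall z, measurable (Z @^-1` [set z]))%classic ->
  'E_P[fun w => f (Z w)]%E = (\sum_z f z * fine (P (Z @^-1` [set z])%classic))%:E.
Proof.
move=> mZ; rewrite unlock.
transitivity (\int[P]_w \sum_z ((f z)%:E * (\1_(Z @^-1` [set z]) w)%:E))%E.
  apply: eq_integral => w _; rewrite sumEFin (bigD1 (Z w)) //= indicE mem_set //.
  rewrite mulr1 big1 ?addr0 // => z /eqP zZ.
  by rewrite indicE memNset ?mulr0 // => /= /esym.
rewrite integral_sum //=; last first.
  by move=> z; apply: integrableZl => //; exact: integrable_indic.
rewrite -sumEFin; apply: eq_bigr => z _.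
rewrite integralZl //; last exact: integrable_indic.
by rewrite integral_indic // setIT EFinM fineK // fin_num_measure.
Qed.

Variables (S : finType) (mu : S -> R) (Q : S -> S -> R) (X : nat -> T -> S).
Hypothesis X_markov : is_markov_chain P mu Q X.

Definition trajectory m w : {ffun 'I_m.+1 -> S} := [ffun k : 'I_m.+1 => X k w].

Lemma trajectory_preimage m x :
  (trajectory m @^-1` [set x] =
   [set w | forall k, (k <= m)%N -> X k w = x (inord k)])%classic.
Proof.
apply/seteqP; split => w /= => [<- k km|Xx].
  by rewrite ffunE inordK.
by apply/ffunP => k; rewrite ffunE Xx ?inord_val // -ltnS.
Qed.

Lemma measurable_trajectory m x : measurable (trajectory m @^-1` [set x])%classic.
Proof.
case: X_markov => mX _ _.
rewrite (_ : _ @^-1` _ =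
    \bigcap_(k in [set: 'I_m.+1]) (X k @^-1` [set x k]))%classic.
  refine (@fin_bigcap_measurable d T _ _ _ (@finite_finset 'I_m.+1 _) _) => k _.
  exact: mX.
apply/seteqP; split=> w /=; first by move=> <- k _ /=; rewrite ffunE.
by move=> Xx; apply/ffunP => k; rewrite ffunE; exact: Xx.
Qed.

(** The Markov property is given on cylinders, so the expectation is expanded
    over the whole trajectory up to time m, which is a random element of a
    finite type; the state at time m + 1 is then integrated out with [Q]. *)
Lemma expectation_markov_step m (g h : S -> R) (c : R) :
    (forall i, \sum_j Q i j * h j = c * h i) ->
  ('E_P[fun w => (g (X 0%N w) * h (X m.+1 w))%R] =
   c%:E * 'E_P[fun w => (g (X 0%N w) * h (X m w))%R])%E.
Proof.
move=> Qh; have [mX _ step] := X_markov.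
have X0E w : X 0%N w = trajectory m w ord0 by rewrite ffunE.
have XmE w : X m w = trajectory m w ord_max by rewrite ffunE.
pose Z w := (trajectory m w, X m.+1 w).
have ZE x j : (Z @^-1` [set (x, j)] =
    (trajectory m @^-1` [set x]) `&` (X m.+1 @^-1` [set j]))%classic.
  by apply/seteqP; rewrite /Z; split => w /= [-> ->].
pose G (x : {ffun 'I_m.+1 -> S}) := g (x ord0) * h (x ord_max).
pose H (u : {ffun 'I_m.+1 -> S} * S) := g (u.1 ord0) * h u.2.
have -> : (fun w => g (X 0%N w) * h (X m w)) = fun w => G (trajectory m w).
  by apply/funext => w; rewrite X0E XmE.
have -> : (fun w => g (X 0%N w) * h (X m.+1 w)) = fun w => H (Z w).
  by apply/funext => w; rewrite X0E.
rewrite (expectation_finite G (@measurable_trajectory m)) expectation_finite.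
  2: by move=> [x j]; rewrite ZE; apply: measurableI => //;
        exact: measurable_trajectory.
rewrite -EFinM; congr _%:E; rewrite mulr_sumr.
transitivity (\sum_x \sum_j H (x, j) * fine (P (Z @^-1` [set (x, j)])%classic)).
  by rewrite pair_big; apply: eq_bigr => -[].
apply: eq_bigr => x _.
transitivity (\sum_j g (x ord0) * fine (P (trajectory m @^-1` [set x])%classic)
                     * (Q (x ord_max) j * h j)).
  apply: eq_bigr => j _; rewrite ZE trajectory_preimage step fineM //; last first.
    rewrite fin_num_measure // -trajectory_preimage.
    exact: measurable_trajectory.
  rewrite /= (_ : inord m = ord_max); last by apply: val_inj; rewrite /= inordK.
  by rewrite /H /=; ring.
by rewrite -mulr_sumr Qh /G; ring.
Qed.

Lemma expectation_markov_eigen m (g h : S -> R) (c : R) :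
    (forall i, \sum_j Q i j * h j = c * h i) ->
  ('E_P[fun w => (g (X 0%N w) * h (X m w))%R] =
   (c ^+ m * \sum_i mu i * (g i * h i))%:E)%E.
Proof.
move=> Qh; elim: m => [|m IH]; last first.
  by rewrite (expectation_markov_step m g Qh) IH -EFinM exprS mulrA.
have [mX X0 _] := X_markov.
rewrite (@expectation_finite S (X 0%N) (fun i => g i * h i)) // mul1r.
by congr _%:E; apply: eq_bigr => i _; rewrite X0 mulrC.
Qed.
End FiniteChain.

(** * Stationary mean and covariance *)

Theorem theorem1p7 (R : realType) (neg : bool) (b n : nat) (p : R)
    (hb : (2 <= b)%N) (hn : (0 < n)%N) (hp : 1 <= p)
    (hbp : admissible neg b p)
    (d : measure_display) (T : measurableType d) (P : probability T R)
    (pi : carries_state n p -> R)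
    (hpi : is_stationary_distribution (@carries_transition R neg b n p) pi)
    (kappa : nat -> T -> carries_state n p)
    (hkappa : is_carries_process P neg b pi kappa)
    (r : nat) :
  ('E_P[carry_value kappa 0%N] = ((n%:R + 1) / 2 - 1 / p)%:E)%E /\
  ((2 <= n)%N ->
   (covariance P (carry_value kappa r) (carry_value kappa 0%N) =
    (1 / (signed_base R neg b) ^+ r * ((n%:R + 1) / 12))%:E)%E).
Proof.
have Qdev := carries_transition_dev hb hn hp hbp.
have mean m : 'E_P[carry_value kappa m]%E = (carry_mean n p)%:E.
  have [mX _ _] := hkappa.
  pose q j := fine (P (kappa m @^-1` [set j])%classic).
  have Ef (f : carries_state n p -> R) :
      'E_P[fun w => f (kappa m w)]%E = (\sum_j f j * q j)%:E.
    by rewrite expectation_finite.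
  have q1 : \sum_j 1 * q j = 1.
    by apply: EFin_inj; rewrite -Ef expectation_cst.
  have q0 : \sum_j carry_dev j * q j = 0.
    apply: EFin_inj; rewrite -Ef.
    (* Pairing h with the constant 1 gives its mean at time m. *)
    have := expectation_markov_eigen hkappa m (fun=> 1) Qdev.
    under eq_fun do rewrite mul1r; move=> ->.
    under eq_bigr do rewrite mul1r.
    by rewrite (stationary_dev hb hn hp hbp hpi) mulr0.
  rewrite (Ef (fun j => (j : nat)%:R)); congr _%:E.
  transitivity (\sum_j carry_dev j * q j + carry_mean n p * \sum_j 1 * q j).
    rewrite mulr_sumr -big_split /=; apply: eq_bigr => j _.
    by rewrite /carry_dev; ring.
  by rewrite q0 q1 add0r mulr1.
split=> [|n2]; first exact: mean.
rewrite unlock !mean /=.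
have -> : ((carry_value kappa r \- cst (carry_mean n p)) *
   (carry_value kappa 0 \- cst (carry_mean n p)) = fun w =>
   carry_dev (kappa 0%N w) * carry_dev (kappa r w))%R.
  by apply/funext => w; rewrite mulrC.
rewrite (expectation_markov_eigen hkappa r _ Qdev) exprVn div1r.
by congr (_ * _)%:E; exact: (stationary_dev_sqr hb hn hp hbp hpi).
Qed.
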